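(* Let $\ell\in\frac12\mathbb{N}$, $\ell>0$, and $\nu>0$. With the matrix-valued Gegenbauer weights $W^{(\nu)}$, $W^{(\nu+1)}$ and the matrix-valued polynomials $\Phi^{(\nu)}$, $\Psi^{(\nu)}$ defined in the context, for $x\in(-1,1)$, $$\frac{d(W^{(\nu)}\Phi^{(\nu)})}{dx}(x)=W^{(\nu)}(x)\Psi^{(\nu)}(x),\qquad W^{(\nu+1)}(x)=c^{(\nu)}\,W^{(\nu)}(x)\Phi^{(\nu)}(x),$$ $$c^{(\nu)}=\frac{(2\nu+1)(2\ell+\nu+1)\,\ell^2}{\nu(2\nu+2\ell+1)(2\ell+\nu)(\ell+\nu)}.$$
   Context: Matrices are $(2\ell+1)\times(2\ell+1)$, indexed by $\{0,1,\dots,2\ell\}$; $E_{i,j}$ are the matrix units; $(a)_0=1$, $(a)_n=a(a+1)\cdots(a+n-1)$. The Gegenbauer polynomials are $C^{(\nu)}_n(x)=\frac{(2\nu)_n}{n!}\,{}_2F_1\!\left(-n,\,n+2\nu;\,\nu+\tfrac12;\,\tfrac12(1-x)\right)$. Definition of the weight. For $x\in(-1,1)$ and $m,n\in\{0,\dots,2\ell\}$ with $n\ge m$, $$\bigl(W^{(\nu)}(x)\bigr)_{m,n}=(1-x^2)^{\nu-1/2}\sum_{t=\max(0,n+m-2\ell)}^{m}\alpha^{(\nu)}_t(m,n)\,C^{(\nu)}_{m+n-2t}(x),$$ $$\alpha^{(\nu)}_t(m,n)=(-1)^m\frac{n!\,m!\,(m+n-2t)!}{t!\,(2\nu)_{m+n-2t}\,(\nu)_{n+m-t}}\,\frac{(\nu)_{n-t}(\nu)_{m-t}}{(n-t)!\,(m-t)!}\,\frac{n+m-2t+\nu}{n+m-t+\nu}\,(2\ell-m)!\,(n-2\ell)_{m-t}\,(-2\ell-\nu)_t\,\frac{2\ell+\nu}{(2\ell)!},$$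 and $W^{(\nu)}(x)$ is extended to a symmetric matrix. Definition of $\Phi^{(\nu)}$ and $\Psi^{(\nu)}$: $$\Phi^{(\nu)}(x)=\Phi(x)+\frac{(\ell+\nu)^2}{\ell^2}(1-x^2)\mathrm{I},$$ $$\Phi(x)=x^2\sum_{i=0}^{2\ell}\frac{(\ell-i)^2}{\ell^2}E_{i,i}+x\sum_{i=1}^{2\ell}\frac{(i-1-2\ell)(2\ell-2i+1)}{2\ell^2}E_{i,i-1}+x\sum_{i=0}^{2\ell-1}\frac{(i+1)(2\ell-2i-1)}{2\ell^2}E_{i,i+1}$$ $$\qquad+\sum_{i=2}^{2\ell}\frac{(2\ell-i+2)(2\ell-i+1)}{4\ell^2}E_{i,i-2}+\sum_{i=0}^{2\ell}\frac{-i(2\ell-i+1)-(2\ell-i)(i+1)}{4\ell^2}E_{i,i}+\sum_{i=0}^{2\ell-2}\frac{(i+2)(i+1)}{4\ell^2}E_{i,i+2},$$ $$\frac{-\ell^2}{2\ell+2\nu+1}\Psi^{(\nu)}(x)=x\sum_{i=0}^{2\ell}(\nu+i)(\nu+2\ell-i)E_{i,i}+\frac12\sum_{i=1}^{2\ell}(i-1-2\ell)(\nu+i-1)E_{i,i-1}-\frac12\sum_{i=0}^{2\ell-1}(i+1)(\nu+2\ell-i-1)E_{i,i+1}.$$ *)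

(* Defs.v *)
From HB Require Import structures.
From mathcomp Require Import all_boot all_order all_algebra.
From mathcomp Require Import all_classical all_reals all_analysis.

Set Implicit Arguments.
Unset Strict Implicit.
Unset Printing Implicit Defensive.

Import Order.TTheory GRing.Theory Num.Theory.
Import numFieldNormedType.Exports.

Local Open Scope ring_scope.

(* The half-integer ell is represented by the natural number L = 2 * ell, so
   matrices have type 'M[R]_L.+1. *)
Definition ell (R : realType) (L : nat) : R := L%:R / 2.
Arguments ell {R} L.

Definition poch (R : realType) (a : R) (n : nat) : R :=
  \prod_(k < n) (a + k%:R).

(* The Gauss series 2F1(a, b; c; z). When a = - n%:R with n : nat, all terms
   of index greater than n vanish, so the limit is a finite sum. *)
Definition hyp2F1 (R : realType) (a b c z : R) : R :=
  limn (series (fun k : nat =>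
    poch a k * poch b k / (poch c k * k`!%:R) * z ^+ k)).

Definition gegenbauer (R : realType) (nu : R) (n : nat) (x : R) : R :=
  poch (2 * nu) n / n`!%:R *
  hyp2F1 (- n%:R) (n%:R + 2 * nu) (nu + 2^-1) (2^-1 * (1 - x)).

(* Natural-number subtractions are only meaningful for t <= m <= n <= L, the
   range in which alpha is used; n%:R - L%:R is a subtraction in R. *)
Definition alpha (R : realType) (L : nat) (nu : R) (t m n : nat) : R :=
  (-1) ^+ m *
  ((n`! * m`! * (m + n - 2 * t)`!)%:R /
   (t`!%:R * poch (2 * nu) (m + n - 2 * t) * poch nu (n + m - t))) *
  (poch nu (n - t) * poch nu (m - t) / ((n - t)`! * (m - t)`!)%:R) *
  ((n%:R + m%:R - 2 * t%:R + nu) / (n%:R + m%:R - t%:R + nu)) *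
  (L - m)`!%:R * poch (n%:R - L%:R) (m - t) * poch (- (2 * ell L) - nu) t *
  ((2 * ell L + nu) / L`!%:R).

(* The truncated subtraction n + m - L in nat is max(0, n + m - 2 ell). *)
Definition weight_upper (R : realType) (L : nat) (nu x : R) (m n : nat) : R :=
  ((1 - x ^+ 2) `^ (nu - 2^-1)) *
  \sum_(n + m - L <= t < m.+1)
     alpha L nu t m n * gegenbauer nu (m + n - 2 * t) x.

Definition weight (R : realType) (L : nat) (nu x : R) : 'M[R]_L.+1 :=
  \matrix_(m, n) if (m <= n)%N then weight_upper L nu x m n
                 else weight_upper L nu x n m.

(* inord is the identity on indices at most L, and every use below is in that
   range. *)
Definition mxunit (R : realType) (L i j : nat) : 'M[R]_L.+1 :=
  delta_mx (inord i) (inord j).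
Arguments mxunit {R} L i j.

Definition Phi0 (R : realType) (L : nat) (x : R) : 'M[R]_L.+1 :=
  let l : R := ell L in
    x ^+ 2 *: (\sum_(0 <= i < L.+1)
       ((l - i%:R) ^+ 2 / l ^+ 2) *: mxunit L i i)
  + x *: (\sum_(1 <= i < L.+1)
       ((i%:R - 1 - 2 * l) * (2 * l - 2 * i%:R + 1) / (2 * l ^+ 2))
         *: mxunit L i (i - 1))
  + x *: (\sum_(0 <= i < L)
       ((i%:R + 1) * (2 * l - 2 * i%:R - 1) / (2 * l ^+ 2))
         *: mxunit L i (i + 1))
  + \sum_(2 <= i < L.+1)
       ((2 * l - i%:R + 2) * (2 * l - i%:R + 1) / (4 * l ^+ 2))
         *: mxunit L i (i - 2)
  + \sum_(0 <= i < L.+1)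
       ((- i%:R * (2 * l - i%:R + 1) - (2 * l - i%:R) * (i%:R + 1))
          / (4 * l ^+ 2)) *: mxunit L i i
  + \sum_(0 <= i < L - 1)
       ((i%:R + 2) * (i%:R + 1) / (4 * l ^+ 2)) *: mxunit L i (i + 2).

Definition Phi (R : realType) (L : nat) (nu x : R) : 'M[R]_L.+1 :=
  Phi0 L x + ((ell L + nu) ^+ 2 / ell L ^+ 2 * (1 - x ^+ 2)) *: 1%:M.

(* Psi is characterised by
   (- l^2 / (2 l + 2 nu + 1)) Psi = (the matrix in parentheses). *)
Definition Psi (R : realType) (L : nat) (nu x : R) : 'M[R]_L.+1 :=
  let l : R := ell L in
  (- l ^+ 2 / (2 * l + 2 * nu + 1))^-1 *:
  ( x *: (\sum_(0 <= i < L.+1)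
       ((nu + i%:R) * (nu + 2 * l - i%:R)) *: mxunit L i i)
  + 2^-1 *: (\sum_(1 <= i < L.+1)
       ((i%:R - 1 - 2 * l) * (nu + i%:R - 1)) *: mxunit L i (i - 1))
  - 2^-1 *: (\sum_(0 <= i < L)
       ((i%:R + 1) * (nu + 2 * l - i%:R - 1)) *: mxunit L i (i + 1))).

Definition cnu (R : realType) (L : nat) (nu : R) : R :=
  let l : R := ell L in
  (2 * nu + 1) * (2 * l + nu + 1) * l ^+ 2 /
  (nu * (2 * nu + 2 * l + 1) * (2 * l + nu) * (l + nu)).

(* Main.v *)
(* With p_j = C_j / C_j(1) and the substitution a = n - t, b = m - t, c = t,
   d = L - m - n + t, every entry of the weight becomes, up to the factor
   (1 - x^2)^(nu - 1/2) K m! (L - m)! n! (L - n)! with K depending on L and nu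
   only, the sum over t of
     (nu)_a (nu)_b / (a! b! c! d! (nu)_(a+b+c+1) (nu)_(a+b+d+1))
       * (a + b + nu) p_(a+b)(x).
   This form is symmetric in m and n, and its coefficient vanishes by itself
   as soon as one of a, b, c, d is negative, so that t may range over all
   integers. The factor a + b + nu is the one that occurs in
     2 x (j + nu) p_j = (j + 2 nu) p_(j+1) + j p_(j-1),
     2 (1 - x^2) (j + nu + 1) p_j^(nu+1) = (2 nu + 1) (p_j - p_(j+2)),
     d/dx [(1 - x^2)^(nu+1/2) p_j^(nu+1)]
       = - (2 nu + 1) (1 - x^2)^(nu-1/2) p_(j+1).
   By the first two, W^(nu+1) = c W Phi is an identity between
   coefficients of p_(a+b), a polynomial identity in a, b, c, d, nu after
   clearing a common hypergeometric factor. By the third, W Psi is compared in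
   the same way with the derivative of W^(nu+1) / c = W Phi. *)
Require Import Defs.
From HB Require Import structures.
From mathcomp Require Import all_boot all_order all_algebra.
From mathcomp Require Import all_classical all_reals all_analysis.
From mathcomp Require Import ring lra zify.
Import Order.TTheory GRing.Theory Num.Theory.
Import numFieldNormedType.Exports.
Local Open Scope ring_scope.
Set Implicit Arguments.
Unset Strict Implicit.

(** * Rising factorials *)

Section Pochhammer.
Variable R : realType.
Implicit Types (a nu : R) (n : nat).

Lemma poch0 a : poch a 0 = 1.
Proof. by rewrite /poch big_ord0. Qed.

Lemma pochS a n : poch a n.+1 = poch a n * (a + n%:R).
Proof. by rewrite /poch big_ord_recr. Qed.

Lemma pochSl a n : poch a n.+1 = a * poch (a + 1) n.
Proof.
rewrite /poch big_ord_recl addr0; congr (_ * _).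
by apply: eq_bigr => i _; rewrite /= /bump /= natrD addrA.
Qed.

Lemma pochD a m n : poch a (m + n) = poch a m * poch (a + m%:R) n.
Proof.
elim: n => [|n IH]; first by rewrite addn0 poch0 mulr1.
by rewrite addnS !pochS IH natrD; ring.
Qed.

Lemma poch_gt0 a n : 0 < a -> 0 < poch a n.
Proof. by move=> a0; apply: prodr_gt0 => i _; rewrite ltr_wpDr. Qed.

Lemma poch_neq0 a n : 0 < a -> poch a n != 0.
Proof. by move=> /poch_gt0 h; rewrite gt_eqF. Qed.

(** Serves to turn the factor (n - 2 ell)_(m-t) of [alpha] into a quotient of factorials. *)
Lemma pochN_fact (n k : nat) : (k <= n)%N ->
  poch (- n%:R : R) k * ((n - k)`!)%:R = (-1) ^+ k * n`!%:R.
Proof.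
elim: k => [|k IH] kn; first by rewrite subn0 poch0 expr0.
have nkS : (n - k = (n - k.+1).+1)%N by lia.
have fS : ((n - k)`!)%:R = (n%:R - k%:R) * ((n - k.+1)`!)%:R :> R.
  by rewrite nkS factS natrM -nkS natrB // ltnW.
have := IH (ltnW kn); rewrite fS pochS exprS mulN1r mulNr => <-.
by ring.
Qed.

Lemma pochN_eq0 (n k : nat) : (n < k)%N -> poch (- n%:R : R) k = 0.
Proof.
by move=> nk; rewrite /poch (bigD1 (Ordinal nk)) //= addNr mul0r.
Qed.

End Pochhammer.

(** * Normalised Gegenbauer polynomials in z = (1 - x) / 2 and their contiguous relations *)

Section GegenbauerPolynomials.
Variable R : realType.
Implicit Types (J nu x : R) (j k : nat).

(** The degree [J] is a real number, so that shifts such as [J - 1] always make sense and the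
    contiguous relations become rational identities in [J]. *)
Definition gegen_coef nu J k : R :=
  poch (- J) k * poch (J + 2 * nu) k / (poch (nu + 2^-1) k * k`!%:R).

(* C_j / C_j(1), as a polynomial in z = (1 - x) / 2. *)
Definition gegen_poly nu j : {poly R} :=
  \poly_(k < j.+1) gegen_coef nu j%:R k.

Lemma coef_gegen_poly nu j k : (gegen_poly nu j)`_k = gegen_coef nu j%:R k.
Proof.
rewrite coef_poly; case: ltnP => // jk.
by rewrite /gegen_coef pochN_eq0 // !mul0r.
Qed.

(** Since (-j)_k = 0 for k > j, the partial sums are constant from index j + 1 on. *)
Lemma hyp2F1_gegen nu j x :
  hyp2F1 (- j%:R) (j%:R + 2 * nu) (nu + 2^-1) x = (gegen_poly nu j).[x].
Proof.
rewrite /hyp2F1; apply: cvg_lim => //; apply: cvg_near_cst.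
near=> N; rewrite /series /= horner_poly.
have jN : (j.+1 <= N)%N by near: N; exact: nbhs_infty_ge.
rewrite (big_cat_nat (n := j.+1)) //= [X in _ + X]big_nat_cond.
rewrite [X in _ + X]big1 ?addr0 ?big_mkord //.
move=> i /andP[/andP[ji _] _]. by rewrite pochN_eq0 // !mul0r.
Unshelve. all: by end_near.
Qed.

Lemma gegenbauerE nu j x :
  gegenbauer nu j x = poch (2 * nu) j / j`!%:R
                      * (gegen_poly nu j).[2^-1 * (1 - x)].
Proof. by rewrite /gegenbauer hyp2F1_gegen. Qed.

Lemma natS k : k.+1%:R = k%:R + 1 :> R. Proof. by rewrite -natr1. Qed.

Lemma factS_R k : k.+1`!%:R = (k%:R + 1) * k`!%:R :> R.
Proof. by rewrite factS natrM natr1. Qed.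

Lemma fact_neq0R k : k`!%:R != 0 :> R.
Proof. by rewrite pnatr_eq0 -lt0n fact_gt0. Qed.

Lemma nat1_neq0 k : k%:R + 1 != 0 :> R.
Proof. by rewrite natr1 pnatr_eq0. Qed.

Lemma gegen_coef0 nu J : gegen_coef nu J 0 = 1.
Proof. by rewrite /gegen_coef !poch0 fact0 !mulr1 divff. Qed.

(** With x = 1 - 2 z, this is the coefficient of z^(k+1) in the three-term recurrence. For k > 0 all
    Pochhammer symbols are multiples of those of length k - 1 based at 1 - J, J + 2 nu + 1 and nu +
    1/2, and a rational identity remains. *)
Lemma gegen_coef_rec nu J k : 0 < nu ->
  2 * (J + nu) * (gegen_coef nu J k.+1 - 2 * gegen_coef nu J k) =
  (J + 2 * nu) * gegen_coef nu (J + 1) k.+1 + J * gegen_coef nu (J - 1) k.+1.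
Proof.
move=> nu0.
have h1 : 2 * nu + 1 != 0 by rewrite gt_eqF //; lra.
case: k => [|k].
  rewrite /gegen_coef !pochS !poch0 /=. by field; rewrite fact_neq0R mulrC h1.
have Z0 : poch (nu + 2^-1) k != 0 by apply: poch_neq0; lra.
have h2 : k%:R + 1 != 0 :> R by apply: nat1_neq0.
have h3 : k%:R + 1 + 1 != 0 :> R by rewrite natr1 nat1_neq0.
have h4 : 2 * nu + 1 + 2 * k%:R != 0.
  by rewrite gt_eqF // ltr_wpDr ?mulr_ge0 //; lra.
have h5 : 2 * nu + 1 + 2 * (k%:R + 1) != 0.
  by rewrite gt_eqF // ltr_wpDr ?mulr_ge0 ?addr_ge0 //; lra.
have Q0 := fact_neq0R k.
have e1 : poch (- J) k.+2 = - J * poch (1 - J) k * (1 - J + k%:R).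
  by rewrite pochSl addrC pochS; ring.
have e2 : poch (- J) k.+1 = - J * poch (1 - J) k by rewrite pochSl addrC.
have e3 : poch (- (J + 1)) k.+2 = - (J + 1) * - J * poch (1 - J) k.
  rewrite pochSl (_ : - (J + 1) + 1 = - J) ?e2 ?mulrA //; ring.
have e4 : poch (- (J - 1)) k.+2 =
    poch (1 - J) k * (1 - J + k%:R) * (1 - J + k%:R + 1).
  by rewrite opprB !pochS natS; ring.
set Y := poch (J + 2 * nu + 1) k.
have f1 : poch (J + 2 * nu) k.+2 = (J + 2 * nu) * Y * (J + 2 * nu + 1 + k%:R).
  by rewrite pochSl pochS mulrA.
have f2 : poch (J + 2 * nu) k.+1 = (J + 2 * nu) * Y by rewrite pochSl.
have f3 : poch (J + 1 + 2 * nu) k.+2 =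
    Y * (J + 2 * nu + 1 + k%:R) * (J + 2 * nu + 2 + k%:R).
  rewrite !pochS natS (_ : J + 1 + 2 * nu = J + 2 * nu + 1); last by ring.
  by rewrite -/Y; ring.
have f4 : poch (J - 1 + 2 * nu) k.+2 = (J - 1 + 2 * nu) * (J + 2 * nu) * Y.
  rewrite pochSl (_ : J - 1 + 2 * nu + 1 = J + 2 * nu) ?f2 ?mulrA //; ring.
rewrite /gegen_coef e1 e2 e3 e4 f1 f2 f3 f4 !factS_R !pochS !(natS k).
move: Z0 Q0; move: (poch (nu + 2^-1) k) (k`!%:R) => Z Q Z0 Q0.
by field;  rewrite Z0 Q0 h2 h3 !(mulrC _ 2) h4 h5.
Qed.

(** Since 1 - x^2 = 4 (z - z^2), this is the coefficient of z^(k+2) in the relation between the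
    parameters nu + 1 and nu. *)
Lemma gegen_coef_nu1 nu J k : 0 < nu ->
  8 * (J + nu + 1) * (gegen_coef (nu + 1) J k.+1 - gegen_coef (nu + 1) J k) =
  (2 * nu + 1) * (gegen_coef nu J k.+2 - gegen_coef nu (J + 2) k.+2).
Proof.
move=> nu0.
have h1 : 2 * nu + 1 != 0 by rewrite gt_eqF //; lra.
have Z0 : poch (nu + 1 + 2^-1) k != 0 by apply: poch_neq0; lra.
have h2 : k%:R + 1 != 0 :> R by apply: nat1_neq0.
have h3 : k%:R + 1 + 1 != 0 :> R by rewrite natr1 nat1_neq0.
have h4 : 2 * (nu + 1) + 1 + 2 * k%:R != 0.
  by rewrite gt_eqF // ltr_wpDr ?mulr_ge0 //; lra.
have h4' : 2 * nu + 1 + 2 * (k%:R + 1) != 0.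
  by rewrite gt_eqF // ltr_wpDr ?mulr_ge0 ?addr_ge0 //; lra.
have Q0 := fact_neq0R k.
have e1 : poch (- (J + 2)) k.+2 = (J + 2) * (J + 1) * poch (- J) k.
  rewrite !pochSl (_ : - (J + 2) + 1 + 1 = - J); last by ring.
  by rewrite (_ : - (J + 2) + 1 = - (J + 1)); ring.
have e2 : poch (nu + 2^-1) k.+2 =
    (nu + 2^-1) * poch (nu + 1 + 2^-1) k * (nu + 1 + 2^-1 + k%:R).
  by rewrite pochSl pochS addrAC mulrA.
have f1 : poch (J + 2 * nu) k.+2 =
    (J + 2 * nu) * (J + 2 * nu + 1) * poch (J + 2 * (nu + 1)) k.
  rewrite !pochSl mulrA (_ : J + 2 * nu + 1 + 1 = J + 2 * (nu + 1)) //; ring.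
have f2 : poch (J + 2 + 2 * nu) k.+2 = poch (J + 2 * (nu + 1)) k *
     (J + 2 * (nu + 1) + k%:R) * (J + 2 * (nu + 1) + k%:R + 1).
  rewrite !pochS natS (_ : J + 2 + 2 * nu = J + 2 * (nu + 1)); last by ring.
  by ring.
rewrite /gegen_coef e1 e2 f1 f2 !factS_R !pochS !(natS k).
move: Z0 Q0; move: (poch (nu + 1 + 2^-1) k) (k`!%:R) => Z Q Z0 Q0.
by field; rewrite ?(Z0,Q0,h2,h3) !(mulrC _ 2) ?h4 ?h1 ?h4'.
Qed.

(** The coefficient of z^(k+1) in [gegen_poly_deriv]. *)
Lemma gegen_coef_deriv nu J k : 0 < nu ->
  (2 * k.+1%:R + 2 * nu + 1) * gegen_coef (nu + 1) J k.+1
    - 2 * (k%:R + 2 * nu + 1) * gegen_coef (nu + 1) J k =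
  (2 * nu + 1) * gegen_coef nu (J + 1) k.+1.
Proof.
move=> nu0.
have h1 : 2 * nu + 1 != 0 by rewrite gt_eqF //; lra.
have Z0 : poch (nu + 1 + 2^-1) k != 0 by apply: poch_neq0; lra.
have h2 : k%:R + 1 != 0 :> R by apply: nat1_neq0.
have h4 : 2 * (nu + 1) + 1 + 2 * k%:R != 0.
  by rewrite gt_eqF // ltr_wpDr ?mulr_ge0 //; lra.
have Q0 := fact_neq0R k.
have e1 : poch (- (J + 1)) k.+1 = - (J + 1) * poch (- J) k.
  by rewrite pochSl (_ : - (J + 1) + 1 = - J) //; ring.
have e2 : poch (nu + 2^-1) k.+1 = (nu + 2^-1) * poch (nu + 1 + 2^-1) k.
  by rewrite pochSl addrAC.
have f1 : poch (J + 1 + 2 * nu) k.+1 =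
    (J + 1 + 2 * nu) * poch (J + 2 * (nu + 1)) k.
  rewrite pochSl (_ : J + 1 + 2 * nu + 1 = J + 2 * (nu + 1)) //; ring.
rewrite /gegen_coef e1 e2 f1 !factS_R !pochS !(natS k).
move: Z0 Q0; move: (poch (nu + 1 + 2^-1) k) (k`!%:R) => Z Q Z0 Q0.
by field; rewrite ?(Z0,Q0,h2) !(mulrC _ 2) h1 h4.
Qed.

Lemma gegen_poly_rec nu j : 0 < nu ->
  (2 * (j%:R + nu)) *: (gegen_poly nu j - 2 *: (gegen_poly nu j * 'X)) =
  (j%:R + 2 * nu) *: gegen_poly nu j.+1 + j%:R *: gegen_poly nu j.-1.
Proof.
move=> nu0; apply/polyP => -[|k].
  by rewrite !(coefZ, coefN, coefD, coefMX) /= !coef_gegen_poly !gegen_coef0; ring.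
rewrite !(coefZ, coefN, coefD, coefMX) /= !coef_gegen_poly gegen_coef_rec //.
congr (_ + _); first by rewrite (natS j).
(* At [j = 0] the degrees -1 and [0.-1 = 0] disagree, but the factor [j] kills both terms. *)
by case: j => [|j]; rewrite ?mul0r //= natS addrK.
Qed.

Lemma gegen_poly_nu1 nu j : 0 < nu ->
  (8 * (j%:R + nu + 1)) *: (gegen_poly (nu + 1) j * ('X - 'X ^+ 2)) =
  (2 * nu + 1) *: (gegen_poly nu j - gegen_poly nu j.+2).
Proof.
move=> nu0; have h1 : 2 * nu + 1 != 0 by rewrite gt_eqF //; lra.
rewrite mulrBr expr2 mulrA; apply/polyP => -[|[|k]].
- by rewrite !(coefZ, coefN, coefD, coefMX) /= !coef_gegen_poly !gegen_coef0; ring.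
- rewrite !(coefZ, coefN, coefD, coefMX) /= !coef_gegen_poly !gegen_coef0.
  rewrite /gegen_coef !pochS !poch0 (_ : 1%N`! = 1%N) // -[j.+2]addn2 natrD.
  by field; rewrite (mulrC _ 2) h1.
rewrite !(coefZ, coefN, coefD, coefMX) /= !coef_gegen_poly gegen_coef_nu1 //.
by rewrite -[j.+2]addn2 natrD.
Qed.

Lemma coef_derivM (p : {poly R}) i : p^`()`_i = p`_i.+1 * i.+1%:R.
Proof. by rewrite coef_deriv mulr_natr. Qed.

(** By d/dx = - (1/2) d/dz and 1 - x^2 = 4 (z - z^2), this is the derivative relation divided by -
    (1 - x^2)^(nu-1/2). *)
Lemma gegen_poly_deriv nu j : 0 < nu ->
  2 *: ((gegen_poly (nu + 1) j)^`() * ('X - 'X ^+ 2))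
    + (2 * nu + 1) *: (gegen_poly (nu + 1) j * (1 - 2 *: 'X)) =
  (2 * nu + 1) *: gegen_poly nu j.+1.
Proof.
move=> nu0; rewrite !mulrBr mulr1 -scalerAr expr2 mulrA; apply/polyP => -[|k].
  by rewrite !(coefZ, coefN, coefD, coefMX) /= !coef_gegen_poly !gegen_coef0; ring.
rewrite !(coefZ, coefN, coefD, coefMX) /= !coef_derivM !coef_gegen_poly (natS j).
rewrite -gegen_coef_deriv //.
case: k => [|k] /=; first by ring.
by rewrite !(natS k.+1) (natS k); ring.
Qed.

End GegenbauerPolynomials.

(** * Coefficients of the weight as functions of integer indices *)

Section Coefficients.
Variable R : realType.
Implicit Types (nu : R) (a b c d k : int).

(** This is 1 / Gamma(k + 1), so its recurrence has no exception at k = -1. *)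
Definition ifact k : R := if k is Posz n then (n`!%:R)^-1 else 0.

(* 1 / (nu)_k = Gamma(nu) / Gamma(nu + k), which is entire in k. *)
Definition ipoch nu k : R :=
  match k with
  | Posz n => (poch nu n)^-1
  | Negz n => \prod_(i < n.+1) (nu - i.+1%:R)
  end.

Definition pochfact nu a : R :=
  if a is Posz n then poch nu n / n`!%:R else 0.

Lemma PoszS (n : nat) : Posz n + 1 = Posz n.+1. Proof. lia. Qed.
Lemma NegzS (n : nat) : Negz n.+1 + 1 = Negz n. Proof. lia. Qed.

Lemma ifactS k : ifact k = (k%:~R + 1) * ifact (k + 1).
Proof.
case: k => [n|[|n]].
- by rewrite PoszS /= factS_R invfM mulVKf // nat1_neq0.
- by rewrite /= addNr mul0r.
- by rewrite NegzS /= mulr0.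
Qed.

Lemma ipochS nu k : 0 < nu -> ipoch nu k = (nu + k%:~R) * ipoch nu (k + 1).
Proof.
move=> nu0; case: k => [n|[|n]].
- by rewrite PoszS /= pochS invfM mulrCA mulfV ?mulr1 // gt_eqF // ltr_wpDr.
- by rewrite /= big_ord1 poch0 invr1 mulr1.
- by rewrite NegzS /= big_ord_recr mulrC.
Qed.

Lemma ipoch_nu1 nu k : 0 < nu -> ipoch (nu + 1) k = nu * ipoch nu (k + 1).
Proof.
move=> nu0; case: k => [n|[|n]].
- by rewrite PoszS /= pochSl invfM mulVKf // gt_eqF.
- by rewrite /= big_ord1 poch0 invr1 mulr1 addrK.
- rewrite NegzS /= big_ord_recl addrK; congr (_ * _); apply: eq_bigr => i _.
  by rewrite /bump /= (natS _ (1 + i)); ring.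
Qed.

Lemma pochfact_nu1 nu a : 0 < nu ->
  nu * pochfact (nu + 1) a = (a%:~R + 1) * pochfact nu (a + 1).
Proof.
move=> nu0; case: a => [n|[|n]].
- rewrite PoszS /= pochSl factS_R.
  by field; rewrite fact_neq0R nat1_neq0.
- by rewrite /= addNr mul0r mulr0.
- by rewrite NegzS /= !mulr0.
Qed.

(* The boundary cases are separate because the parameter y of the last one
   amounts to (nu)_(a-1) / (a+1)!, and (nu)_(-1) = 1 / (nu - 1) has a pole. *)
Variant pochfact_spec nu a : R -> R -> R -> Prop :=
| PochfactNeg of (a < -1)%R : pochfact_spec nu a 0 0 0
| PochfactN1 of a = -1 : pochfact_spec nu a 0 0 1
| Pochfact0 of a = 0 : pochfact_spec nu a 0 1 nu
| PochfactPos y of (1 <= a)%R : pochfact_spec nu a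
    ((a%:~R + 1) * a%:~R * y) ((a%:~R + 1) * (nu + a%:~R - 1) * y)
    ((nu + a%:~R) * (nu + a%:~R - 1) * y).

Lemma pochfactP nu a :
  pochfact_spec nu a (pochfact nu (a - 1)) (pochfact nu a) (pochfact nu (a + 1)).
Proof.
case: a => [[|n]|[|n]].
- rewrite PoszS /= poch0 pochS poch0 fact0 (_ : 1%N`! = 1%N) //.
  by rewrite !divr1 mul1r addr0; apply: Pochfact0.
- have e : Posz n.+1 - 1 = Posz n by lia.
  rewrite e PoszS; set y : R := poch nu n / (n.+2)`!%:R.
  have -> : pochfact nu n = ((Posz n.+1)%:~R + 1) * (Posz n.+1)%:~R * y.
    rewrite /y /= !factS_R (natS _ n); field.
    by rewrite fact_neq0R nat1_neq0 natr1 nat1_neq0.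
  have -> : pochfact nu n.+1 =
      ((Posz n.+1)%:~R + 1) * (nu + (Posz n.+1)%:~R - 1) * y.
    rewrite /y /= pochS !factS_R (natS _ n); field.
    by rewrite fact_neq0R nat1_neq0 natr1 nat1_neq0.
  have -> : pochfact nu n.+2 =
      (nu + (Posz n.+1)%:~R) * (nu + (Posz n.+1)%:~R - 1) * y.
    by rewrite /y /= !pochS !factS_R (natS _ n); ring.
  by apply: PochfactPos; lia.
- by rewrite /= poch0 divr1; apply: PochfactN1.
- by rewrite NegzS; apply: PochfactNeg; lia.
Qed.

(** The factor a + b + nu is left out; it stays next to the Gegenbauer polynomial, where the
    recurrences expect it. *)
Definition wcoef nu a b c d : R :=
  pochfact nu a * pochfact nu b * ifact c * ifact d
  * ipoch nu (a + b + c + 1) * ipoch nu (a + b + d + 1).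

Lemma wcoef_nu1 nu a b c d : 0 < nu ->
  wcoef (nu + 1) a b c d =
  (a%:~R + 1) * (b%:~R + 1) * pochfact nu (a + 1) * pochfact nu (b + 1)
  * ifact c * ifact d * ipoch nu (a + b + c + 2) * ipoch nu (a + b + d + 2).
Proof.
move=> nu0; rewrite /wcoef !ipoch_nu1 //.
have -> : a + b + c + 2 = a + b + c + 1 + 1 by lia.
have -> : a + b + d + 2 = a + b + d + 1 + 1 by lia.
have ha := pochfact_nu1 a nu0; have hb := pochfact_nu1 b nu0.
(* The two factors [nu] released by [ipoch_nu1] are given to the two values of
   [pochfact (nu + 1)]. *)
transitivity (nu * pochfact (nu + 1) a * (nu * pochfact (nu + 1) b)
  * ifact c * ifact d * ipoch nu (a + b + c + 1 + 1)
  * ipoch nu (a + b + d + 1 + 1)); first by ring.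
by rewrite ha hb; ring.
Qed.

(* Compares the coefficients of p_(a+b+1) in W Psi and in the derivative of
   W^(nu+1). *)
Lemma wcoef_Psi nu a b c d : 0 < nu ->
  let L : R := (a + b + c + d)%:~R in
  let n : R := (a + c)%:~R in
  let J : R := (a + b + 1)%:~R in
  (L + 2 * nu) * (nu + L + 1) * (J + nu) * wcoef (nu + 1) a b c d =
  (nu + n) * (nu + L - n) *
    ((J - 1 + 2 * nu) * wcoef nu a b c d
     + (J + 1) * wcoef nu (a + 1) (b + 1) (c - 1) (d - 1))
  - (n + 1) * (nu + n) * (J + nu) * wcoef nu (a + 1) b c (d - 1)
  - (L - n + 1) * (nu + L - n) * (J + nu) * wcoef nu a (b + 1) (c - 1) d.
Proof.
move=> nu0 L n J.
rewrite wcoef_nu1 // /wcoef.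
have -> : a + 1 + (b + 1) + (c - 1) + 1 = a + b + c + 2 by lia.
have -> : a + 1 + (b + 1) + (d - 1) + 1 = a + b + d + 2 by lia.
have -> : a + 1 + b + c + 1 = a + b + c + 2 by lia.
have -> : a + 1 + b + (d - 1) + 1 = a + b + d + 1 by lia.
have -> : a + (b + 1) + (c - 1) + 1 = a + b + c + 1 by lia.
have -> : a + (b + 1) + d + 1 = a + b + d + 2 by lia.
(* All values of [ifact] and [ipoch] are reduced to those at c, d, a + b + c + 2 and a + b + d + 2,
   which then act as free variables. *)
rewrite [ifact (c - 1)]ifactS [ifact (d - 1)]ifactS !subrK.
rewrite [ipoch nu (a + b + c + 1)]ipochS // [ipoch nu (a + b + d + 1)]ipochS //.
rewrite -![_ + 1 + 1]addrA.
move: (ifact c) (ifact d) (ipoch _ _) (ipoch _ _) => C D X Y.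
rewrite /L /n /J !(intrD, intrN) {L n J}.
case: (pochfactP nu a) => [_|->|->|y _];
  by case: (pochfactP nu b) => [_|->|->|z _]; ring.
Qed.

(* Compares the coefficients of p_(a+b) in (1 - x^2) W^(nu+1) and in W Phi; the
   divisions by J - 1 + nu and J + 1 + nu come from multiplying by x twice. *)
Lemma wcoef_Phi nu a b c d : 0 < nu -> 0 <= a + b ->
  let L : R := (a + b + c + d)%:~R in
  let n : R := (a + c)%:~R in
  let J : R := (a + b)%:~R in
  let h i j p q := wcoef nu (a + i) (b + j) (c + p) (d + q) in
  (L + 2 * nu + 1) * (L + 2 * nu) * (nu + L + 1)
    * (wcoef (nu + 1) a b c d
       - wcoef (nu + 1) (a - 1) (b - 1) (c + 1) (d + 1)) =
  - (n + nu) * (L - n + nu) *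
    ((J - 1 + 2 * nu) * ((J - 2 + 2 * nu) * h (-1) (-1) 1 1 + J * h 0 0 0 0)
       / (J - 1 + nu)
     + (J + 1) * ((J + 2 * nu) * h 0 0 0 0 + (J + 2) * h 1 1 (-1) (-1))
       / (J + 1 + nu))
  + ((L + 2 * nu) ^+ 2 - n * (L - n + 1) - (L - n) * (n + 1))
    * (J + nu) * h 0 0 0 0
  + (L - n + 1) * (L - 2 * n + 1) *
    ((J - 1 + 2 * nu) * h (-1) 0 0 1 + (J + 1) * h 0 1 (-1) 0)
  - (n + 1) * (L - 2 * n - 1) *
    ((J - 1 + 2 * nu) * h 0 (-1) 1 0 + (J + 1) * h 1 0 0 (-1))
  + (L - n + 1) * (L - n + 2) * (J + nu) * h (-1) 1 (-1) 1
  + (n + 1) * (n + 2) * (J + nu) * h 1 (-1) 1 (-1).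
Proof.
move=> nu0 ab L n J h.
rewrite !wcoef_nu1 // /h /wcoef !addr0 !subrK.
have -> : a - 1 + (b - 1) + (c + 1) + 2 = a + b + c + 1 by lia.
have -> : a - 1 + (b - 1) + (d + 1) + 2 = a + b + d + 1 by lia.
have -> : a - 1 + (b - 1) + (c + 1) + 1 = a + b + c by lia.
have -> : a - 1 + (b - 1) + (d + 1) + 1 = a + b + d by lia.
have -> : a + 1 + (b + 1) + (c - 1) + 1 = a + b + c + 2 by lia.
have -> : a + 1 + (b + 1) + (d - 1) + 1 = a + b + d + 2 by lia.
have -> : a - 1 + b + c + 1 = a + b + c by lia.
have -> : a - 1 + b + (d + 1) + 1 = a + b + d + 1 by lia.
have -> : a + (b + 1) + (c - 1) + 1 = a + b + c + 1 by lia.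
have -> : a + (b + 1) + d + 1 = a + b + d + 2 by lia.
have -> : a + (b - 1) + (c + 1) + 1 = a + b + c + 1 by lia.
have -> : a + (b - 1) + d + 1 = a + b + d by lia.
have -> : a + 1 + b + c + 1 = a + b + c + 2 by lia.
have -> : a + 1 + b + (d - 1) + 1 = a + b + d + 1 by lia.
have -> : a - 1 + (b + 1) + (c - 1) + 1 = a + b + c by lia.
have -> : a - 1 + (b + 1) + (d + 1) + 1 = a + b + d + 2 by lia.
have -> : a + 1 + (b - 1) + (c + 1) + 1 = a + b + c + 2 by lia.
have -> : a + 1 + (b - 1) + (d - 1) + 1 = a + b + d by lia.
rewrite [ifact (c - 1)]ifactS [ifact (d - 1)]ifactS !subrK.
rewrite [ifact c]ifactS [ifact d]ifactS.
rewrite [ipoch nu (a + b + c)]ipochS // [ipoch nu (a + b + d)]ipochS //.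
rewrite [ipoch nu (a + b + c + 1)]ipochS // [ipoch nu (a + b + d + 1)]ipochS //.
rewrite -![_ + 1 + 1]addrA.
move: (ifact (c + 1)) (ifact (d + 1)) (ipoch nu (a + b + c + (1 + 1)))
  (ipoch nu (a + b + d + (1 + 1))) => C D X Y.
have Jp : J + 1 + nu != 0.
  by rewrite gt_eqF // ltr_wpDl // addr_ge0 // ler0z.
(* For a + b = 0 this denominator is nu - 1, which may vanish. *)
have Jm : J - 1 + nu != 0 \/ a + b = 0.
  have [ab0|ab0] := eqVneq (a + b) 0; [by right | left].
  rewrite gt_eqF // ltr_wpDl // subr_ge0 ler1z; lia.
move: Jp Jm; rewrite /L /n /J !(intrD, intrN) {L n J h}.
case: (pochfactP nu a) => [_|ea|ea|y ha];
  case: (pochfactP nu b) => [_|eb|eb|z hb] Jp Jm; try by ring.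
all: try lia.
all: rewrite ?ea ?eb ?(intrN, mulr0z, mulr1z) in Jp Jm *.
all: rewrite ?(add0r, addr0) in Jp Jm.
(* In the remaining cases that allow a + b = 0, the numerator over a + b - 1 + nu vanishes, so the
   inverse may be replaced by an arbitrary value. *)
all: try (by move: (_ - 1 + nu)^-1 => q; field; rewrite Jp).
all: case: Jm => [Jm|]; last by lia.
all: by field; rewrite Jp.
Qed.

End Coefficients.

(** * Values of the polynomials at x, and their derivative together with the power of 1 - x^2 *)

Section GegenbauerValues.
Variable R : realType.
Implicit Types (nu x : R) (j : int).

Definition gegen nu j x : R :=
  if j is Posz n then (gegen_poly nu n).[2^-1 * (1 - x)] else 0.

Lemma gegen_rec nu j x : 0 < nu -> 0 <= j ->
  2 * x * ((j%:~R + nu) * gegen nu j x) =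
  (j%:~R + 2 * nu) * gegen nu (j + 1) x + j%:~R * gegen nu (j - 1) x.
Proof.
move=> nu0; case: j => // n _; rewrite PoszS.
(* At [n = 0] the value at degree -1 is 0 while [n.-1] gives p_0; the factor [n] hides the
   difference. *)
have -> : (Posz n)%:~R * gegen nu (Posz n - 1) x =
          n%:R * (gegen_poly nu n.-1).[2^-1 * (1 - x)].
  case: n => [|n]; first by rewrite !mul0r.
  by rewrite (_ : Posz n.+1 - 1 = Posz n) //; lia.
have := congr1 (fun p => p.[2^-1 * (1 - x)]) (gegen_poly_rec n nu0).
rewrite !hornerE /= => <-.
by rewrite -[(Posz n)%:~R]/(n%:R); field.
Qed.

Lemma gegen_nu1 nu j x : 0 < nu -> 0 <= j ->
  2 * (1 - x ^+ 2) * ((j%:~R + (nu + 1)) * gegen (nu + 1) j x) =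
  (2 * nu + 1) * (gegen nu j x - gegen nu (j + 2) x).
Proof.
move=> nu0; case: j => // n _; rewrite (_ : Posz n + 2 = n.+2); last by lia.
have := congr1 (fun p => p.[2^-1 * (1 - x)]) (gegen_poly_nu1 n nu0).
rewrite !hornerE /= => <-.
by rewrite -[(Posz n)%:~R]/(n%:R); field.
Qed.

Lemma powR_nu1 nu (y : R) : 0 < y ->
  y `^ (nu + 1 - 2^-1) = y `^ (nu - 2^-1) * y.
Proof.
move=> y0; rewrite (_ : nu + 1 - 2^-1 = nu - 2^-1 + 1); last by ring.
rewrite (@powRD _ _ (nu - 2^-1)); last by apply/implyP => _; rewrite gt_eqF.
by rewrite powRr1 // ltW.
Qed.

(** The product and chain rules leave the common factor (1 - x^2)^(nu-1/2), and [gegen_poly_deriv]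
    evaluates the rest. *)
Lemma is_derive_gegen nu j x : 0 < nu -> 0 <= j -> -1 < x < 1 ->
  is_derive x 1
    (fun y => (1 - y ^+ 2) `^ (nu + 1 - 2^-1) * gegen (nu + 1) j y)
    (- (2 * nu + 1) * (1 - x ^+ 2) `^ (nu - 2^-1) * gegen nu (j + 1) x).
Proof.
move=> nu0; case: j => // n _ /andP[x1 x2]; rewrite PoszS.
have x0 : 0 < 1 - x ^+ 2 by rewrite subr_gt0 expr2; nra.
have dq : is_derive x 1 (fun y : R => 1 - y ^+ 2) (- (2 * x)).
  by apply: is_derive_eq; rewrite -[x%:A]/(x * 1); ring.
have dz : is_derive x 1 (fun y : R => 2^-1 * (1 - y)) (- 2^-1).
  by apply: is_derive_eq; rewrite add0r -[_ *: _]/(2^-1 * _); ring.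
have dp : is_derive x 1 (fun y => (1 - y ^+ 2) `^ (nu + 1 - 2^-1))
   ((nu + 1 - 2^-1) * (1 - x ^+ 2) `^ (nu + 1 - 2^-1 - 1) * - (2 * x)).
  have dw := is_derive1_powR (nu + 1 - 2^-1) x0.
  exact: (@is_derive1_comp _ (fun z => powR z (nu + 1 - 2^-1))
    (fun y => 1 - y ^+ 2)).
have dg : is_derive x 1 (gegen (nu + 1) n)
   ((gegen_poly (nu + 1) n)^`().[2^-1 * (1 - x)] * - 2^-1).
  exact: (@is_derive1_comp _ (horner (gegen_poly (nu + 1) n))
    (fun y => 2^-1 * (1 - y))).
apply: is_derive_eq.
have := congr1 (fun p => p.[2^-1 * (1 - x)]) (gegen_poly_deriv n nu0).
rewrite !hornerE /= => H.
rewrite powR_nu1 // (_ : nu + 1 - 2^-1 - 1 = nu - 2^-1); last by ring.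
set w := _ `^ _; set q := (gegen_poly nu n.+1).[_].
rewrite [RHS](_ : _ = - (w * ((2 * nu + 1) * q))); last by ring.
rewrite -H /GRing.scale /=.
by field.
Qed.

End GegenbauerValues.

(** * Finite sums over an integer window, and their shifts *)

Section WindowSums.
Variables (R : realType) (L : nat).
Implicit Types (F G : int -> R) (nu x : R) (c q : int).

(* Sum over the window [-4, L + 4], wide enough for all the index shifts of
   functions supported in [0, L] that occur. *)
Definition wsum F : R := \sum_(i < L + 9) F (i%:Z - 4).

Lemma eq_wsum F G : F =1 G -> wsum F = wsum G.
Proof. by move=> FG; apply: eq_bigr => i _; rewrite FG. Qed.

Lemma wsumD F G : wsum F + wsum G = wsum (fun c => F c + G c).
Proof. by rewrite /wsum big_split. Qed.

Lemma wsumZ k F : k * wsum F = wsum (fun c => k * F c).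
Proof. by rewrite /wsum mulr_sumr. Qed.

(** The margins make F vanish at -4 and L + 5, the points where a window and its shift by one
    differ. *)
Definition supp F := forall c, ~~ (-2 <= c <= L%:Z + 2) -> F c = 0.

Lemma wsum_shift F : supp F -> wsum (fun c => F (c + 1)) = wsum F.
Proof.
move=> sF; rewrite /wsum addnS [LHS]big_ord_recr [RHS]big_ord_recl /=.
rewrite [X in _ + X = _]sF ?addr0; last by lia.
rewrite [X in _ = X + _]sF ?add0r; last by lia.
apply: eq_bigr => i _; congr F; rewrite /bump /=; lia.
Qed.

Lemma wsum_shiftN F : (forall c, ~~ (-2 <= c < L%:Z + 2) -> F c = 0) ->
  wsum (fun c => F (c - 1)) = wsum F.
Proof.
move=> sF; rewrite -(@wsum_shift (fun c => F (c - 1))).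
  by apply: eq_wsum => c; rewrite addrK.
by move=> c hc; apply: sF; lia.
Qed.

(** The recurrence splits each term into degrees q - 2 c + 1 and q - 2 c - 1. The second is q + 1 -
    2 (c + 1), so that replacing c by c - 1 brings both parts to the same degree. The last
    hypothesis removes the negative degrees, to which the recurrence does not apply. *)
Lemma wsum_mulx nu F q x : 0 < nu ->
  (forall c, ~~ (-2 <= c < L%:Z + 2) -> F c = 0) ->
  (forall c, q - 2 * c < 0 -> F c = 0) ->
  2 * x * wsum (fun c => F c * ((q - 2 * c)%:~R + nu) * gegen nu (q - 2 * c) x) =
  wsum (fun c => (F c * ((q - 2 * c)%:~R + 2 * nu)
                  + F (c - 1) * ((q - 2 * c)%:~R + 2))
                 * gegen nu (q + 1 - 2 * c) x).
Proof.
move=> nu0 sF F0.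
pose B c := F c * (q - 2 * c)%:~R * gegen nu (q - 2 * c - 1) x.
transitivity (wsum (fun c => F c * ((q - 2 * c)%:~R + 2 * nu)
                             * gegen nu (q + 1 - 2 * c) x) + wsum B).
  rewrite wsumZ wsumD; apply: eq_wsum => c; rewrite /B.
  have [qc|qc] := ltP (q - 2 * c) 0; first by rewrite F0 // !(mul0r, mulr0) addr0.
  rewrite (_ : q + 1 - 2 * c = q - 2 * c + 1); last by lia.
  transitivity (F c * (2 * x * (((q - 2 * c)%:~R + nu) * gegen nu (q - 2 * c) x))).
    by ring.
  by rewrite gegen_rec //; ring.
rewrite -(@wsum_shiftN B); last by move=> c /sF h; rewrite /B h !mul0r.
rewrite wsumD; apply: eq_wsum => c; rewrite /B.
rewrite (_ : q - 2 * (c - 1) - 1 = q + 1 - 2 * c); last by lia.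
rewrite (_ : q - 2 * (c - 1) = q - 2 * c + 2); last by lia.
by rewrite [(_ + 2)%:~R]intrD; ring.
Qed.

End WindowSums.

(** * The polynomial part of the weight entries and its expansions *)

Section WeightSums.
Variables (R : realType) (L : nat).
Implicit Types (nu x : R) (m n c : int).

Definition tcoef nu m n c : R :=
  wcoef nu (n - c) (m - c) c (L%:Z - m - n + c).

Lemma tcoefE nu m n c a b d : n - c = a -> m - c = b ->
  L%:Z - m - n + c = d -> tcoef nu m n c = wcoef nu a b c d.
Proof. by move=> <- <- <-. Qed.

Lemma tcoef_neg nu m n c : m + n - 2 * c < 0 -> tcoef nu m n c = 0.
Proof.
move=> h; rewrite /tcoef /wcoef.
have [hn|hn] := ltP (n - c) 0.
  by case: (n - c) hn => // ?; rewrite !mul0r.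
have : m - c < 0 by lia.
by case: (m - c) => // ?; rewrite mulr0 !mul0r.
Qed.

Lemma tcoef_out nu m n c : 0 <= m <= L%:Z -> ~~ (0 <= c <= L%:Z) ->
  tcoef nu m n c = 0.
Proof.
move=> hm hc; rewrite /tcoef /wcoef.
have [c0|c0] := ltP c 0.
  by case: c c0 {hc} => // ? _; rewrite mulr0 !mul0r.
have : m - c < 0 by lia.
by case: (m - c) => // ?; rewrite mulr0 !mul0r.
Qed.

(** The four indices satisfy a + c = n and b + d = L - n, so one of them is negative. *)
Lemma tcoef_col_out nu m n c : 0 <= m <= L%:Z -> ~~ (0 <= n <= L%:Z) ->
  tcoef nu m n c = 0.
Proof.
move=> hm hn; rewrite /tcoef /wcoef.
have [c0|c0] := ltP c 0.
  by case: c c0 => // ? _; rewrite mulr0 !mul0r.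
have [n0|n0] := ltP n 0.
  have : n - c < 0 by lia.
  by case: (n - c) => // ?; rewrite !mul0r.
have [mc|mc] := ltP (m - c) 0.
  by case: (m - c) mc => // ?; rewrite mulr0 !mul0r.
have : L%:Z - m - n + c < 0 by lia.
by case: (L%:Z - m - n + c) => // ?; rewrite mulr0 !mul0r.
Qed.

(** Integer indices admit the columns n - 2, ..., n + 2 at the edge of the matrix as well, where the
    value is 0. *)
Definition wpoly nu m n x : R :=
  wsum L (fun c => tcoef nu m n c * ((m + n - 2 * c)%:~R + nu)
                   * gegen nu (m + n - 2 * c) x).

Lemma wpoly_out nu m n x : 0 <= m <= L%:Z -> ~~ (0 <= n <= L%:Z) ->
  wpoly nu m n x = 0.
Proof.
by move=> hm hn; apply: big1 => i _; rewrite tcoef_col_out // !mul0r.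
Qed.

Definition mulx_coef nu m n c : R :=
  tcoef nu m n c * ((m + n - 2 * c)%:~R + 2 * nu)
  + tcoef nu m n (c - 1) * ((m + n - 2 * c)%:~R + 2).

Lemma wpoly_mulx nu m n x : 0 < nu -> 0 <= m <= L%:Z ->
  2 * x * wpoly nu m n x =
  wsum L (fun c => mulx_coef nu m n c * gegen nu (m + n + 1 - 2 * c) x).
Proof.
move=> nu0 hm; rewrite wsum_mulx //.
- by move=> c hc; apply: tcoef_out => //; lia.
- by move=> c hc; apply: tcoef_neg.
Qed.

(** After one multiplication by 2 x the factor degree + nu is gone. Dividing by it and putting it
    back permits a second use of [wsum_mulx], whence the two denominators. *)
Lemma wpoly_mulx2 nu m n x : 0 < nu -> 0 <= m <= L%:Z ->
  4 * x ^+ 2 * wpoly nu m n x =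
  wsum L (fun c =>
    (mulx_coef nu m n (c + 1) * ((m + n - 2 * c)%:~R - 1 + 2 * nu)
       / ((m + n - 2 * c)%:~R - 1 + nu)
     + mulx_coef nu m n c * ((m + n - 2 * c)%:~R + 1)
       / ((m + n - 2 * c)%:~R + 1 + nu))
    * gegen nu (m + n - 2 * c) x).
Proof.
move=> nu0 hm.
have mu_out c : ~~ (-1 <= c < L%:Z + 2) -> mulx_coef nu m n c = 0.
  by move=> hc; rewrite /mulx_coef !tcoef_out ?mul0r ?addr0 //; lia.
have mu_neg c : m + n + 1 - 2 * c < 0 -> mulx_coef nu m n c = 0.
  move=> hc; rewrite /mulx_coef tcoef_neg ?mul0r ?add0r; last by lia.
  (* Here the coefficient at c - 1 belongs to degree 0 and need not vanish, but its factor m + n - 2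
     c + 2 does. *)
  have [e|e] := eqVneq (m + n - 2 * c) (-2); first by rewrite e intrN addNr mulr0.
  by rewrite tcoef_neg ?mul0r //; lia.
pose F c := mulx_coef nu m n c / ((m + n + 1 - 2 * c)%:~R + nu).
have -> : 4 * x ^+ 2 * wpoly nu m n x = 2 * x * (2 * x * wpoly nu m n x) by ring.
rewrite wpoly_mulx //.
have -> : wsum L (fun c => mulx_coef nu m n c * gegen nu (m + n + 1 - 2 * c) x) =
  wsum L (fun c => F c * ((m + n + 1 - 2 * c)%:~R + nu)
                   * gegen nu (m + n + 1 - 2 * c) x).
  apply: eq_wsum => c; have [hc|hc] := ltP (m + n + 1 - 2 * c) 0.
    by rewrite /F mu_neg // !mul0r.
  by rewrite /F divfK // gt_eqF // ltr_wpDl // ler0z.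
rewrite wsum_mulx //; first last.
- by move=> c hc; rewrite /F mu_neg // mul0r.
- by move=> c hc; rewrite /F mu_out ?mul0r //; lia.
rewrite -wsum_shift; last first.
  move=> c hc; rewrite /F !mu_out ?mul0r ?addr0 ?mul0r //; lia.
apply: eq_wsum => c; rewrite /F addrK.
rewrite (_ : m + n + 1 - 2 * (c + 1) = m + n - 2 * c - 1); last by lia.
rewrite (_ : m + n + 1 + 1 - 2 * (c + 1) = m + n - 2 * c); last by lia.
rewrite (_ : m + n + 1 - 2 * c = m + n - 2 * c + 1); last by lia.
by rewrite !intrD !intrN; ring.
Qed.

Lemma wpoly_nu1 nu m n x : 0 < nu -> 0 <= m <= L%:Z ->
  2 * (1 - x ^+ 2) * wpoly (nu + 1) m n x =
  wsum L (fun c => (2 * nu + 1) *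
    (tcoef (nu + 1) m n c - tcoef (nu + 1) m n (c + 1))
    * gegen nu (m + n - 2 * c) x).
Proof.
move=> nu0 hm.
pose B c := - (2 * nu + 1) * tcoef (nu + 1) m n c * gegen nu (m + n - 2 * c + 2) x.
transitivity (wsum L (fun c => (2 * nu + 1) * tcoef (nu + 1) m n c
    * gegen nu (m + n - 2 * c) x) + wsum L B).
  rewrite wsumZ wsumD; apply: eq_wsum => c; rewrite /B.
  have [hc|hc] := ltP (m + n - 2 * c) 0; first by rewrite tcoef_neg //; ring.
  transitivity (tcoef (nu + 1) m n c * (2 * (1 - x ^+ 2) *
    (((m + n - 2 * c)%:~R + (nu + 1)) * gegen (nu + 1) (m + n - 2 * c) x))).
    by ring.
  by rewrite gegen_nu1 //; ring.
rewrite -(@wsum_shift _ L B); last first.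
  by move=> c hc; rewrite /B tcoef_out ?mulr0 ?mul0r //; lia.
rewrite wsumD; apply: eq_wsum => c; rewrite /B.
rewrite (_ : m + n - 2 * (c + 1) + 2 = m + n - 2 * c); last by lia.
by ring.
Qed.

Lemma wpoly_shiftS2 nu m n x : 0 <= m <= L%:Z ->
  wpoly nu m (n + 2) x = wsum L (fun c => tcoef nu m (n + 2) (c + 1)
    * ((m + n - 2 * c)%:~R + nu) * gegen nu (m + n - 2 * c) x).
Proof.
move=> hm; rewrite /wpoly -wsum_shift; last first.
  by move=> c hc; rewrite tcoef_out ?mul0r //; lia.
apply: eq_wsum => c.
by rewrite (_ : m + (n + 2) - 2 * (c + 1) = m + n - 2 * c); last by lia.
Qed.

Lemma wpoly_shiftB2 nu m n x : 0 <= m <= L%:Z ->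
  wpoly nu m (n - 2) x = wsum L (fun c => tcoef nu m (n - 2) (c - 1)
    * ((m + n - 2 * c)%:~R + nu) * gegen nu (m + n - 2 * c) x).
Proof.
move=> hm; rewrite /wpoly -wsum_shiftN; last first.
  by move=> c hc; rewrite tcoef_out ?mul0r //; lia.
apply: eq_wsum => c.
by rewrite (_ : m + (n - 2) - 2 * (c - 1) = m + n - 2 * c); last by lia.
Qed.

Lemma wpoly_mulx_shiftB1 nu m n x : 0 < nu -> 0 <= m <= L%:Z ->
  2 * x * wpoly nu m (n - 1) x = wsum L (fun c =>
    (tcoef nu m (n - 1) c * ((m + n - 2 * c)%:~R - 1 + 2 * nu)
     + tcoef nu m (n - 1) (c - 1) * ((m + n - 2 * c)%:~R + 1))
    * gegen nu (m + n - 2 * c) x).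
Proof.
move=> nu0 hm; rewrite wpoly_mulx //; apply: eq_wsum => c; rewrite /mulx_coef.
rewrite (_ : m + (n - 1) + 1 - 2 * c = m + n - 2 * c); last by lia.
rewrite (_ : m + (n - 1) - 2 * c = m + n - 2 * c - 1); last by lia.
by rewrite [(_ - 1)%:~R]intrD; ring.
Qed.

Lemma wpoly_mulx_shiftS1 nu m n x : 0 < nu -> 0 <= m <= L%:Z ->
  2 * x * wpoly nu m (n + 1) x = wsum L (fun c =>
    (tcoef nu m (n + 1) (c + 1) * ((m + n - 2 * c)%:~R - 1 + 2 * nu)
     + tcoef nu m (n + 1) c * ((m + n - 2 * c)%:~R + 1))
    * gegen nu (m + n - 2 * c) x).
Proof.
move=> nu0 hm; rewrite wpoly_mulx // -wsum_shift; last first.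
  by move=> c hc; rewrite /mulx_coef !tcoef_out ?(mul0r, addr0) //; lia.
apply: eq_wsum => c; rewrite /mulx_coef addrK.
rewrite (_ : m + (n + 1) + 1 - 2 * (c + 1) = m + n - 2 * c); last by lia.
rewrite (_ : m + (n + 1) - 2 * (c + 1) = m + n - 2 * c - 1); last by lia.
by rewrite [(_ - 1)%:~R]intrD; ring.
Qed.

(** Once every term is expanded at the common degree m + n - 2 c, [wcoef_Phi] gives the equality for
    each c. The large bracket is the one that [row_Phi] produces. *)
Lemma wpoly_Phi nu m n x : 0 < nu -> 0 <= m <= L%:Z ->
  let l : R := L%:R in let k : R := n%:~R in
  let V n := wpoly nu m n x in
  (l + 2 * nu + 1) * (l + 2 * nu) * (nu + l + 1)
    * (2 * (1 - x ^+ 2) * wpoly (nu + 1) m n x) =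
  (2 * nu + 1) *
  ((- (4 * (k + nu) * (l - k + nu)) * x ^+ 2
     + (l + 2 * nu) ^+ 2 - k * (l - k + 1) - (l - k) * (k + 1)) * V n
   + 2 * x * (l - k + 1) * (l - 2 * k + 1) * V (n - 1)
   - 2 * x * (k + 1) * (l - 2 * k - 1) * V (n + 1)
   + (l - k + 1) * (l - k + 2) * V (n - 2)
   + (k + 1) * (k + 2) * V (n + 2)).
Proof.
move=> nu0 hm l k V.
transitivity ((2 * nu + 1) *
  (- ((k + nu) * (l - k + nu)) * (4 * x ^+ 2 * V n)
   + ((l + 2 * nu) ^+ 2 - k * (l - k + 1) - (l - k) * (k + 1)) * V n
   + (l - k + 1) * (l - 2 * k + 1) * (2 * x * V (n - 1))
   + - ((k + 1) * (l - 2 * k - 1)) * (2 * x * V (n + 1))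
   + (l - k + 1) * (l - k + 2) * V (n - 2)
   + (k + 1) * (k + 2) * V (n + 2))); last by ring.
rewrite /V wpoly_nu1 // wpoly_mulx2 // wpoly_mulx_shiftB1 // wpoly_mulx_shiftS1 //.
rewrite wpoly_shiftB2 // wpoly_shiftS2 // /wpoly !wsumZ !wsumD wsumZ.
apply: eq_wsum => c.
(* At negative degree [gegen] is 0; otherwise a + b >= 0, as [wcoef_Phi] demands. *)
have [hc|hc] := ltP (m + n - 2 * c) 0.
  by case: (m + n - 2 * c) hc => // i _; rewrite /= !mulr0 !addr0 mulr0.
pose a := n - c; pose b := m - c; pose d := L%:Z - m - n + c.
have hab : 0 <= a + b by rewrite /a /b; lia.
have := wcoef_Phi c d nu0 hab.
have eL : (a + b + c + d)%:~R = l.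
  by rewrite -[l]/((Posz L)%:~R) /a /b /d; congr (_%:~R); lia.
have en : (a + c)%:~R = k by rewrite /a subrK.
have eJ : a + b = m + n - 2 * c by rewrite /a /b; lia.
rewrite /= eL en eJ !addr0.
have -> : tcoef nu m (n - 1) c = wcoef nu (a - 1) b c (d + 1).
  by apply: tcoefE; rewrite /a /b /d; lia.
have -> : tcoef nu m (n - 1) (c - 1) = wcoef nu a (b + 1) (c - 1) d.
  by apply: tcoefE; rewrite /a /b /d; lia.
have -> : tcoef nu m (n + 1) (c + 1) = wcoef nu a (b - 1) (c + 1) d.
  by apply: tcoefE; rewrite /a /b /d; lia.
have -> : tcoef nu m (n + 1) c = wcoef nu (a + 1) b c (d - 1).
  by apply: tcoefE; rewrite /a /b /d; lia.
have -> : tcoef nu m (n - 2) (c - 1) = wcoef nu (a - 1) (b + 1) (c - 1) (d + 1).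
  by apply: tcoefE; rewrite /a /b /d; lia.
have -> : tcoef nu m (n + 2) (c + 1) = wcoef nu (a + 1) (b - 1) (c + 1) (d - 1).
  by apply: tcoefE; rewrite /a /b /d; lia.
rewrite /mulx_coef addrK.
have Et e : tcoef e m n (c + 1) = wcoef e (a - 1) (b - 1) (c + 1) (d + 1).
  by apply: tcoefE; rewrite /a /b /d; lia.
have -> : tcoef nu m n (c - 1) = wcoef nu (a + 1) (b + 1) (c - 1) (d - 1).
  by apply: tcoefE; rewrite /a /b /d; lia.
rewrite !Et -![tcoef _ m n c]/(wcoef _ a b c d).
have -> : (m + n - 2 * (c + 1))%:~R = (m + n - 2 * c)%:~R - 2 :> R.
  by rewrite mulrDr opprD addrA [(_ - 2 * 1)%:~R]intrD mulr1 intrN.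
move: (m + n - 2 * c) => j; move: (gegen nu j x) j%:~R => g J.
do 9! move: (wcoef _ _ _ _ _) => ?.
move: (J - 1 + nu)^-1 (J + 1 + nu)^-1 => q1 q2.
move/(congr1 (fun y => (2 * nu + 1) * g * y)) => /= H.
by etransitivity; [|etransitivity; [exact: H|]]; ring.
Qed.

(** The sum on the left is what differentiating an entry of W^(nu+1) leaves, with degrees raised by
    one; the right-hand side is the bracket of [row_Psi]. [wcoef_Psi] compares them for each c. *)
Lemma wpoly_Psi nu m n x : 0 < nu -> 0 <= m <= L%:Z ->
  let l : R := L%:R in let k : R := n%:~R in
  let V n := wpoly nu m n x in
  (l + 2 * nu) * (nu + l + 1) *
    wsum L (fun c => tcoef (nu + 1) m n c * ((m + n - 2 * c)%:~R + (nu + 1))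
                     * gegen nu (m + n - 2 * c + 1) x) =
  (nu + k) * (nu + l - k) * (2 * x * V n)
  - (k + 1) * (nu + k) * V (n + 1)
  - (l - k + 1) * (nu + l - k) * V (n - 1).
Proof.
move=> nu0 hm l k V.
transitivity ((nu + k) * (nu + l - k) * (2 * x * V n)
  + - ((k + 1) * (nu + k)) * V (n + 1)
  + - ((l - k + 1) * (nu + l - k)) * V (n - 1)); last by ring.
(* Shifting c raises the degree from m + n - 1 - 2 c to m + n + 1 - 2 c, the degree of the other
   terms. *)
have e : V (n - 1) = wsum L (fun c => tcoef nu m (n - 1) (c - 1)
    * ((m + (n - 1) - 2 * (c - 1))%:~R + nu)
    * gegen nu (m + (n - 1) - 2 * (c - 1)) x).
  rewrite /V /wpoly -wsum_shiftN // => c hc.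
  by rewrite tcoef_out ?mul0r //; lia.
rewrite {}e /V wpoly_mulx // /wpoly !wsumZ !wsumD.
apply: eq_wsum => c.
pose a := n - c; pose b := m - c; pose d := L%:Z - m - n + c.
have := wcoef_Psi a b c d nu0.
have eL : (a + b + c + d)%:~R = l.
  by rewrite -[l]/((Posz L)%:~R) /a /b /d; congr (_%:~R); lia.
have en : (a + c)%:~R = k by rewrite /a subrK.
have eJ : a + b = m + n - 2 * c by rewrite /a /b; lia.
rewrite /= eL en eJ.
have -> : tcoef nu m (n + 1) c = wcoef nu (a + 1) b c (d - 1).
  by apply: tcoefE; rewrite /a /b /d; lia.
have -> : tcoef nu m (n - 1) (c - 1) = wcoef nu a (b + 1) (c - 1) d.
  by apply: tcoefE; rewrite /a /b /d; lia.
rewrite /mulx_coef.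
have -> : tcoef nu m n (c - 1) = wcoef nu (a + 1) (b + 1) (c - 1) (d - 1).
  by apply: tcoefE; rewrite /a /b /d; lia.
rewrite -![tcoef _ m n c]/(wcoef _ a b c d).
rewrite (_ : m + (n + 1) - 2 * c = m + n - 2 * c + 1); last by lia.
rewrite (_ : m + (n - 1) - 2 * (c - 1) = m + n - 2 * c + 1); last by lia.
rewrite (_ : m + n + 1 - 2 * c = m + n - 2 * c + 1); last by lia.
rewrite [(_ + 1)%:~R]intrD.
move: (m + n - 2 * c) => j; move: (gegen nu (j + 1) x) j%:~R => g J.
do 5! move: (wcoef _ _ _ _ _) => ?.
move/(congr1 (fun y => g * y)) => /= H.
by etransitivity; [|etransitivity; [exact: H|]]; ring.
Qed.

End WeightSums.

(** * Identification of the weight entries with the symmetric form *)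

Section WeightEntries.
Variables (R : realType) (L : nat).
Implicit Types (nu x : R) (m n : nat).

Lemma wsum_nat (F : int -> R) : (forall c, ~~ (0 <= c <= L%:Z) -> F c = 0) ->
  wsum L F = \sum_(t < L.+1) F t.
Proof.
move=> F0; rewrite /wsum (_ : L + 9 = 4 + (L.+1 + 4))%N; last by lia.
rewrite !big_split_ord /= big1 ?add0r; last first.
  by move=> i _; apply: F0; have := ltn_ord i; lia.
rewrite [X in _ + X]big1 ?addr0; last first.
  by move=> i _; apply: F0; rewrite /=; lia.
by apply: eq_bigr => i _; congr F; rewrite /=; lia.
Qed.

(** The factors are the same up to sign, in reverse order. This turns (-2 ell - nu)_t into the last
    t factors of (nu)_(2 ell + 1). *)
Lemma poch_reflect (a : R) k : poch (- (a + k%:R - 1)) k = (-1) ^+ k * poch a k.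
Proof.
elim: k => [|k IH]; first by rewrite !poch0 expr0 mulr1.
rewrite pochSl (natS _ k) (_ : - (a + (k%:R + 1) - 1) + 1 = - (a + k%:R - 1)).
  by rewrite IH pochS exprS; ring.
by ring.
Qed.

(** The constant K of the overview times a row factor and a column factor; the column factor can
    thus be treated separately in products with band matrices. *)
Definition wscale nu m n : R :=
  (L%:R + nu) * poch nu L.+1 / L`!%:R
  * (m`!%:R * (L - m)`!%:R) * (n`!%:R * (L - n)`!%:R).

(** The sign (-1)^m = (-1)^(b+c) cancels those of (-(b+d))_b and (-2 ell - nu)_c, and (2 nu)_(a+b) /
    (a+b)! cancels between [alpha] and C_(a+b). *)
Lemma alphaE nu x a b c d : 0 < nu -> L = (a + b + c + d)%N ->
  alpha L nu c (b + c) (a + c) * gegenbauer nu (b + c + (a + c) - 2 * c) x =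
  wscale nu (b + c) (a + c) *
  (wcoef nu a b c d * ((a + b)%:R + nu) * gegen nu (a + b)%N x).
Proof.
move=> nu0 eL; rewrite /alpha /wscale /wcoef gegenbauerE.
have -> : (b + c + (a + c) - 2 * c = a + b)%N by lia.
have -> : (a + c + (b + c) - c = a + b + c)%N by lia.
have -> : (a + c - c = a)%N by lia.
have -> : (b + c - c = b)%N by lia.
have -> : (L - (b + c) = a + d)%N by lia.
have -> : (L - (a + c) = b + d)%N by lia.
have -> : 2 * ell L = L%:R :> R by rewrite /ell; field.
have -> : (a + c)%:R - L%:R = - (b + d)%:R :> R by rewrite eL !natrD; ring.
have -> : Posz a + b + c + 1 = (a + b + c).+1 by lia.
have -> : Posz a + b + d + 1 = (a + b + d).+1 by lia.
rewrite /= [poch nu (a + b + c).+1]pochS.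
have /(canRL (mulfK (fact_neq0R _ _))) -> := @pochN_fact R (b + d) b (leq_addr _ _).
rewrite (_ : b + d - b = d)%N; last by lia.
have -> : - L%:R - nu = - ((nu + (a + b + d).+1%:R) + c%:R - 1) :> R.
  by rewrite eL !natrD (natS _ (a + b + d)) !natrD; ring.
rewrite poch_reflect exprD.
have -> : poch nu L.+1 =
    poch nu (a + b + d).+1 * poch (nu + (a + b + d).+1%:R) c.
  by rewrite -pochD; congr poch; lia.
have s1 (e : nat) : (-1) ^+ e * (-1) ^+ e = 1 :> R by rewrite -expr2 sqrr_sign.
have P2 : poch (2 * nu) (a + b) != 0 by apply: poch_neq0; lra.
have Pc : poch nu (a + b + c) != 0 by apply: poch_neq0.
have Pd : poch nu (a + b + d).+1 != 0 by apply: poch_neq0.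
have jc : nu + (a + b + c)%:R != 0 by rewrite gt_eqF // ltr_wpDr.
rewrite !natrM.
move: (s1 b) (s1 c) (fact_neq0R R a) (fact_neq0R R b) (fact_neq0R R c)
  (fact_neq0R R d) (fact_neq0R R (a + b)) (fact_neq0R R L) P2 Pc Pd jc.
rewrite !natrD.
move: ((-1) ^+ b) ((-1) ^+ c) => eb ec hb hc a0 b0 c0 d0 ab0 L0 P2 Pc Pd jc.
(* The squares of the signs are inserted on the right, since [field] sees the signs as free
   variables. *)
rewrite -[RHS]mul1r -[X in _ = X * _](_ : eb * eb * (ec * ec) = 1); last first.
  by rewrite hb hc mulr1.
by field; rewrite a0 b0 c0 d0 ab0 L0 P2 Pc Pd jc.
Qed.

Lemma tcoefC nu (m n c : int) : tcoef L nu m n c = tcoef L nu n m c.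
Proof.
rewrite /tcoef /wcoef [L%:Z - m - n]addrAC [m - c + (n - c)]addrC.
by rewrite [pochfact nu (n - c) * _]mulrC.
Qed.

Lemma wpolyC nu x (m n : int) : wpoly L nu m n x = wpoly L nu n m x.
Proof. by apply: eq_wsum => c; rewrite tcoefC [m + n]addrC. Qed.

Lemma weight_upperE nu x m n : 0 < nu -> (m <= n <= L)%N ->
  weight_upper L nu x m n =
  (1 - x ^+ 2) `^ (nu - 2^-1) * (wscale nu m n * wpoly L nu m n x).
Proof.
move=> nu0 /andP[mn nL]; rewrite /weight_upper; congr (_ * _).
have m_in : 0 <= m%:Z <= L%:Z by lia.
rewrite /wpoly wsum_nat; last by move=> c hc; rewrite tcoef_out ?mul0r.
rewrite -(big_mkord xpredT (fun t : nat => tcoef L nu m n t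
  * ((m%:Z + n%:Z - 2 * t%:Z)%:~R + nu) * gegen nu (m%:Z + n%:Z - 2 * t%:Z) x)).
have mL : (m.+1 <= L.+1)%N by lia.
have nmL : (n + m - L <= m.+1)%N by lia.
(* The terms with t > m vanish because b < 0, those with t < n + m - L because d < 0. *)
rewrite [in RHS](big_cat_nat (n := m.+1)) //=.
rewrite [in RHS](big_cat_nat (n := (n + m - L)%N) (p := m.+1)) //=.
rewrite [X in _ * ((X + _) + _)]big1_seq ?add0r; last first.
  move=> t; rewrite mem_index_iota => /andP[_ ht].
  rewrite /tcoef /wcoef; have : L%:Z - m%:Z - n%:Z + t%:Z < 0 by lia.
  by case: (L%:Z - m%:Z - n%:Z + t%:Z) => // ? _; rewrite mulr0 !mul0r.
rewrite [X in _ * (_ + X)]big1_seq ?addr0; last first.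
  move=> t; rewrite mem_index_iota => /andP[_ ht].
  rewrite /tcoef /wcoef; have : m%:Z - t%:Z < 0 by lia.
  by case: (m%:Z - t%:Z) => // ? _; rewrite mulr0 !mul0r.
rewrite mulr_sumr; apply: eq_big_nat => t /andP[t1 t2].
have e := @alphaE nu x (n - t) (m - t) t (L + t - n - m) nu0.
rewrite !subnK in e; [|lia|lia].
rewrite e; last by lia.
rewrite /tcoef.
have -> : Posz (n - t) = n%:Z - t%:Z by lia.
have -> : Posz (m - t) = m%:Z - t%:Z by lia.
have -> : Posz (L + t - n - m) = L%:Z - m%:Z - n%:Z + t%:Z by lia.
have -> : Posz (n - t + (m - t)) = m%:Z + n%:Z - 2 * t%:Z by lia.
rewrite -[(n - t + (m - t))%:R]/((Posz (n - t + (m - t)))%:~R).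
by have -> : Posz (n - t + (m - t)) = m%:Z + n%:Z - 2 * t%:Z by lia.
Qed.

Lemma weightE nu x (m n : 'I_L.+1) : 0 < nu ->
  weight L nu x m n =
  (1 - x ^+ 2) `^ (nu - 2^-1) * (wscale nu m n * wpoly L nu m n x).
Proof.
move=> nu0; rewrite mxE; case: leqP => mn.
  by rewrite weight_upperE // mn -ltnS ltn_ord.
have nmL : (n <= m <= L)%N by rewrite ltnW //= -ltnS ltn_ord.
rewrite weight_upperE // wpolyC.
by have -> : wscale nu n m = wscale nu m n by rewrite /wscale mulrAC.
Qed.

End WeightEntries.

(** * Products of a matrix row with the bands of Phi and Psi *)

Section BandMatrices.
Variables (R : realType) (L : nat).
Implicit Types (M N : 'M[R]_L.+1) (i j : nat) (f : nat -> R) (g : nat -> nat).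

Lemma addmx_ij M N (i j : 'I_L.+1) : (M + N) i j = M i j + N i j.
Proof. by rewrite mxE. Qed.

Lemma scalemx_ij (a : R) M (i j : 'I_L.+1) : (a *: M) i j = a * M i j.
Proof. by rewrite mxE. Qed.

Lemma oppmx_ij M (i j : 'I_L.+1) : (- M) i j = - M i j.
Proof. by rewrite mxE. Qed.

Lemma mulmx_mxunit M i j (m n : 'I_L.+1) : (j <= L)%N ->
  (M *m mxunit L i j) m n = M m (inord i) * (j == n)%:R.
Proof.
move=> jL; rewrite mxE (bigD1 (inord i)) //= big1 ?addr0; last first.
  by move=> k /negPf kn; rewrite mxE kn mulr0.
by rewrite mxE eqxx -val_eqE /= inordK // eq_sym.
Qed.

(** A band meets column [n] in at most one row, namely [i0] if it lies in the range. *)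
Lemma mulmx_sum_mxunit M f g p q (m n : 'I_L.+1) i0 :
  (forall i, (p <= i < q)%N -> (g i <= L)%N && ((g i == n) == (i == i0))) ->
  (M *m \sum_(p <= i < q) f i *: mxunit L i (g i)) m n =
  if (p <= i0 < q)%N then f i0 * M m (inord i0) else 0.
Proof.
move=> gP.
transitivity (\sum_(p <= i < q | i == i0) f i * M m (inord i)); last first.
  exact: big_nat1_eq.
rewrite mulmx_sumr summxE [RHS]big_mkcond; apply: eq_big_nat => i hi.
have /andP[gL /eqP <-] := gP i hi.
rewrite -scalemxAr mxE mulmx_mxunit //.
by case: eqP => _; rewrite ?mulr1 ?mulr0.
Qed.

Variables (M : 'M[R]_L.+1) (m : 'I_L.+1) (A : R) (v : int -> R).
Hypothesis rowM : forall k : 'I_L.+1,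
  M m k = A * (k`!%:R * (L - k)`!%:R) * v k.
Hypothesis v_out : forall k : int, ~~ (0 <= k <= L%:Z) -> v k = 0.
Variable n : 'I_L.+1.
(** All row products are expressed by this value at column [n]: on passing to a neighbour, the
    change of k! (L - k)! is absorbed by the linear factors of the band coefficients. *)
Let E := A * (n`!%:R * (L - n)`!%:R).

Lemma rowM_inord i : (i <= L)%N ->
  M m (inord i) = A * (i`!%:R * (L - i)`!%:R) * v i.
Proof. by move=> iL; rewrite rowM inordK. Qed.

Lemma row_diag f :
  (M *m \sum_(0 <= i < L.+1) f i *: mxunit L i i) m n = f n * E * v n.
Proof.
rewrite (@mulmx_sum_mxunit _ _ _ _ _ _ _ n) => [|i hi]; last by lia.
by rewrite ltn_ord rowM_inord ?mulrA //; have := ltn_ord n; lia.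
Qed.

Lemma row_sub1 f (phi : R -> R) :
  (forall i, f i = (i%:R - 1 - L%:R) * phi i%:R) ->
  (M *m \sum_(1 <= i < L.+1) f i *: mxunit L i (i - 1)) m n =
  - (n%:R + 1) * phi (n%:R + 1) * E * v (n%:Z + 1).
Proof.
move=> fE; rewrite (@mulmx_sum_mxunit _ _ _ _ _ _ _ n.+1) => [|i hi]; last by lia.
case: ifP => hn; last by rewrite v_out ?mulr0 //; have := ltn_ord n; lia.
rewrite rowM_inord; last by lia.
rewrite fE /E (_ : L - n = (L - n.+1).+1)%N; last by lia.
rewrite !factS_R !(natS _ n) natrB; last by lia.
by rewrite (natS _ n) PoszS; ring.
Qed.

Lemma row_sup1 f (phi : R -> R) :
  (forall i, f i = (i%:R + 1) * phi i%:R) ->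
  (M *m \sum_(0 <= i < L) f i *: mxunit L i (i + 1)) m n =
  (L%:R - n%:R + 1) * phi (n%:R - 1) * E * v (n%:Z - 1).
Proof.
have nL := ltn_ord n; case en : (n : nat) => [|k] fE.
  (* The superdiagonal does not meet column 0; [L] is a dummy row outside the range. *)
  rewrite (@mulmx_sum_mxunit _ _ _ _ _ _ _ L) => [|i hi]; last by lia.
  by rewrite ltnn andbF v_out ?mulr0 //.
rewrite (@mulmx_sum_mxunit _ _ _ _ _ _ _ k) => [|i hi]; last by lia.
have kL : (0 <= k < L)%N by lia.
rewrite kL rowM_inord; last by lia.
rewrite fE /E en (_ : L - k = (L - k.+1).+1)%N; last by lia.
rewrite (_ : Posz k.+1 - 1 = k); last by lia.
rewrite !factS_R (natS _ k) addrK natrB; last by lia.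
by rewrite (natS _ k); ring.
Qed.

Lemma row_sub2 f (phi : R) :
  (forall i, f i = (L%:R - i%:R + 2) * (L%:R - i%:R + 1) * phi) ->
  (M *m \sum_(2 <= i < L.+1) f i *: mxunit L i (i - 2)) m n =
  (n%:R + 1) * (n%:R + 2) * phi * E * v (n%:Z + 2).
Proof.
move=> fE; rewrite (@mulmx_sum_mxunit _ _ _ _ _ _ _ n.+2) => [|i hi]; last by lia.
case: ifP => hn; last by rewrite v_out ?mulr0 //; have := ltn_ord n; lia.
rewrite rowM_inord; last by lia.
rewrite fE /E (_ : L - n = (L - n.+2).+2)%N; last by lia.
rewrite (_ : n%:Z + 2 = n.+2); last by lia.
rewrite !factS_R !(natS _ (L - n.+2)) !(natS _ n.+1) !(natS _ n) natrB; last by lia.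
by rewrite (natS _ n.+1) (natS _ n); ring.
Qed.

Lemma row_sup2 f (phi : R) :
  (forall i, f i = (i%:R + 2) * (i%:R + 1) * phi) ->
  (M *m \sum_(0 <= i < L - 1) f i *: mxunit L i (i + 2)) m n =
  (L%:R - n%:R + 1) * (L%:R - n%:R + 2) * phi * E * v (n%:Z - 2).
Proof.
have nL := ltn_ord n; case: (leqP 2 n) => n2 fE; last first.
  (* Columns 0 and 1 are not met either, and [L] is again a dummy row. *)
  rewrite (@mulmx_sum_mxunit _ _ _ _ _ _ _ L) => [|i hi]; last by lia.
  case: ifP => hL; first by lia.
  by rewrite v_out ?mulr0 //; lia.
have [k en] : exists k : nat, n = k.+2 :> nat by exists (n - 2)%N; lia.
rewrite (@mulmx_sum_mxunit _ _ _ _ _ _ _ k) => [|i hi]; last by lia.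
have kL : (0 <= k < L - 1)%N by lia.
rewrite kL rowM_inord; last by lia.
rewrite fE /E en (_ : L - k = (L - k.+2).+2)%N; last by lia.
rewrite (_ : Posz k.+2 - 2 = k); last by lia.
rewrite !factS_R !(natS _ (L - k.+2)) !(natS _ k.+1) !(natS _ k) natrB; last by lia.
by rewrite (natS _ k.+1) (natS _ k); ring.
Qed.

Hypothesis L0 : (0 < L)%N.
Let l0 : L%:R != 0 :> R. Proof. by rewrite pnatr_eq0 -lt0n. Qed.

(** The multiple of the identity in Phi makes the coefficient of x^2 factor: (l - 2 k)^2 - (l + 2
    nu)^2 = - 4 (k + nu) (l - k + nu). *)
Lemma row_Phi nu x : let l : R := L%:R in let k : R := n%:R in
  l ^+ 2 * (M *m Phi L nu x) m n = E *
  ((- (4 * (k + nu) * (l - k + nu)) * x ^+ 2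
     + (l + 2 * nu) ^+ 2 - k * (l - k + 1) - (l - k) * (k + 1)) * v n
   + 2 * x * (l - k + 1) * (l - 2 * k + 1) * v (n%:Z - 1)
   - 2 * x * (k + 1) * (l - 2 * k - 1) * v (n%:Z + 1)
   + (l - k + 1) * (l - k + 2) * v (n%:Z - 2)
   + (k + 1) * (k + 2) * v (n%:Z + 2)).
Proof.
move=> l k; rewrite /Phi /Phi0 /= !mulmxDr -!scalemxAr mulmx1.
rewrite !(addmx_ij, scalemx_ij).
have e2 : 2 * ell L = l by rewrite /ell; field.
have e4 : ell L ^+ 2 = l ^+ 2 / 4 by rewrite /ell; field.
rewrite !row_diag.
rewrite (@row_sub1 _ (fun y => (l - 2 * y + 1) / (2 * (l ^+ 2 / 4)))); last first.
  by move=> i; rewrite e2 e4 -mulrA.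
rewrite (@row_sup1 _ (fun y => (l - 2 * y - 1) / (2 * (l ^+ 2 / 4)))); last first.
  by move=> i; rewrite e2 e4 -mulrA.
rewrite (@row_sub2 _ ((4 * (l ^+ 2 / 4))^-1)); last first.
  by move=> i; rewrite e2 e4.
rewrite (@row_sup2 _ ((4 * (l ^+ 2 / 4))^-1)); last first.
  by move=> i; rewrite e4.
rewrite rowM -/E /ell -/l -/k.
by field.
Qed.

Lemma row_Psi nu x : 0 < nu -> let l : R := L%:R in let k : R := n%:R in
  l ^+ 2 * (M *m Psi L nu x) m n = - 2 * (l + 2 * nu + 1) * E *
  ((nu + k) * (nu + l - k) * (2 * x * v n)
   - (k + 1) * (nu + k) * v (n%:Z + 1)
   - (l - k + 1) * (nu + l - k) * v (n%:Z - 1)).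
Proof.
move=> nu0 l k; rewrite /Psi /= -!scalemxAr mulmxBr mulmxDr -!scalemxAr.
rewrite !(addmx_ij, oppmx_ij, scalemx_ij).
have e2 : 2 * ell L = l by rewrite /ell; field.
have e4 : ell L ^+ 2 = l ^+ 2 / 4 by rewrite /ell; field.
rewrite row_diag.
rewrite (@row_sub1 _ (fun y => nu + y - 1)); last by move=> i; rewrite e2.
rewrite (@row_sup1 _ (fun y => nu + l - y - 1)); last first.
  by move=> i; rewrite e2 // -!addrA.
have h1 : l + 2 * nu + 1 != 0.
  by rewrite gt_eqF // ltr_wpDl // addr_ge0 // mulr_ge0 // ltW.
rewrite e2 e4 -/l -/k.
by field; rewrite l0 h1.
Qed.

End BandMatrices.

(** * Entrywise differentiation and the theorem *)

Section Derivatives.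
Variable R : realType.

Lemma ord_int_le L (m : 'I_L.+1) : 0 <= m%:Z <= L%:Z.
Proof. by have := ltn_ord m; lia. Qed.

Lemma is_derive_mx p q (F : R -> 'M[R]_(p.+1, q.+1)) (x : R)
    (D : 'M[R]_(p.+1, q.+1)) :
  (forall i j, is_derive x 1 (fun y => F y i j) (D i j)) -> is_derive x 1 F D.
Proof.
move=> H; have dF : derivable F x 1.
  by apply/derivable_mxP => i j; apply: ex_derive.
apply: DeriveDef => //; rewrite derive_mx //; apply/matrixP => i j.
by rewrite mxE; apply: derive_val.
Qed.

Lemma is_derive_wpoly L nu (m n : nat) (x : R) : 0 < nu -> -1 < x < 1 ->
  is_derive x 1
    (fun y => (1 - y ^+ 2) `^ (nu + 1 - 2^-1) * wpoly L (nu + 1) m n y)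
    (- (2 * nu + 1) * (1 - x ^+ 2) `^ (nu - 2^-1) *
     wsum L (fun c => tcoef L (nu + 1) m n c
                      * ((m%:Z + n%:Z - 2 * c)%:~R + (nu + 1))
                      * gegen nu (m%:Z + n%:Z - 2 * c + 1) x)).
Proof.
move=> nu0 hx; rewrite wsumZ /wsum.
pose h (i : 'I_(L + 9)) y :=
  let c := i%:Z - 4 in
  (tcoef L (nu + 1) m n c * ((m%:Z + n%:Z - 2 * c)%:~R + (nu + 1))) *
  ((1 - y ^+ 2) `^ (nu + 1 - 2^-1) * gegen (nu + 1) (m%:Z + n%:Z - 2 * c) y).
have -> : (fun y => (1 - y ^+ 2) `^ (nu + 1 - 2^-1) * wpoly L (nu + 1) m n y) =
          \sum_(i < L + 9) h i.
  apply/funext => y; rewrite fct_sumE mulr_sumr; apply: eq_bigr => i _.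
  by rewrite /h /=; ring.
apply: is_derive_sum => i; rewrite /h.
set c := i%:Z - 4; set j := m%:Z + n%:Z - 2 * c.
(* For j = -1 the polynomial of degree j + 1 is not 0, so the vanishing of the coefficient is what
   counts. *)
have [j0|j0] := ltP j 0.
  have -> : tcoef L (nu + 1) m n c = 0 by exact: tcoef_neg.
  rewrite !(mul0r, mulr0).
  by under eq_fun do rewrite mul0r; exact: is_derive_cst.
have dg := is_derive_gegen nu0 j0 hx.
apply: is_derive_eq.
rewrite /GRing.scale /=; ring.
Qed.

End Derivatives.

Theorem theorem2p4 (R : realType) (L : nat) (hL : (0 < L)%N) (nu : R)
    (hnu : 0 < nu) (x : R) (hx : -1 < x < 1) :
  is_derive x (1 : R) (fun y : R => weight L nu y *m Phi L nu y)
    (weight L nu x *m Psi L nu x) /\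
  weight L (nu + 1) x = cnu L nu *: (weight L nu x *m Phi L nu x).
Proof.
have nu1 : 0 < nu + 1 by rewrite ltr_wpDr.
set l : R := L%:R.
have l_gt0 : 0 < l by rewrite ltr0n.
have l0 : l != 0 by rewrite gt_eqF.
have nz1 : 2 * nu + 1 != 0 by rewrite gt_eqF //; lra.
have nz2 : 2 * nu + l + 1 != 0 by rewrite gt_eqF //; lra.
have nz3 : l + nu != 0 by rewrite gt_eqF //; lra.
have nz4 : l + 2 * nu != 0 by rewrite gt_eqF //; lra.
have nz5 : l + nu + 1 != 0 by rewrite gt_eqF //; lra.
have nu_neq0 : nu != 0 by rewrite gt_eqF.
have cE : cnu L nu = (2 * nu + 1) * (l + nu + 1) * l ^+ 2 /
    (2 * nu * (2 * nu + l + 1) * (l + nu) * (l + 2 * nu)).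
  rewrite /cnu /ell -/l; field.
  by rewrite nz4 nz3 nz2.
pose A (mu y : R) (m : 'I_L.+1) : R := (1 - y ^+ 2) `^ (mu - 2^-1) *
  ((l + mu) * poch mu L.+1 / L`!%:R * (m`!%:R * (L - m)`!%:R)).
have rowW (mu y : R) m (mu0 : 0 < mu) (k : 'I_L.+1) : weight L mu y m k =
    A mu y m * (k`!%:R * (L - k)`!%:R) * wpoly L mu m k y.
  by rewrite weightE // /wscale /A -/l; ring.
have v_out (mu y : R) (m : 'I_L.+1) (k : int) : ~~ (0 <= k <= L%:Z) ->
    wpoly L mu m k y = 0.
  exact/wpoly_out/ord_int_le.
(* The ratio of the constants K for nu + 1 and nu. *)
have KE : (l + (nu + 1)) * poch (nu + 1) L.+1 =
   (l + nu + 1) * (nu + l + 1) / nu * poch nu L.+1.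
  by rewrite [in RHS]pochSl pochS -/l; field.
(* Proved on the whole interval, since the derivative at [x] needs the identity near [x]. *)
have WS (y : R) : -1 < y < 1 ->
    weight L (nu + 1) y = cnu L nu *: (weight L nu y *m Phi L nu y).
  move=> /andP[y1 y2].
  have y0 : 0 < 1 - y ^+ 2 by rewrite subr_gt0 expr2; nra.
  apply/matrixP => m n.
  have hm := ord_int_le m.
  have H1 := row_Phi (rowW nu y m hnu) (v_out nu y m) n hL nu y.
  have H2 := @wpoly_Phi R L nu m n y hnu hm.
  (* The common bracket is made opaque, so that [field] sees a single variable. *)
  have {H1 H2} [B [H1 H2]] : exists B,
    l ^+ 2 * (weight L nu y *m Phi L nu y) m n
      = A nu y m * (n`!%:R * (L - n)`!%:R) * B /\
    (l + 2 * nu + 1) * (l + 2 * nu) * (nu + l + 1)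
      * (2 * (1 - y ^+ 2) * wpoly L (nu + 1) m n y) = (2 * nu + 1) * B.
    by eexists; split; [exact: H1 | exact: H2].
  have ew : (1 - y ^+ 2) `^ (nu + 1 - 2^-1) =
      (1 - y ^+ 2) `^ (nu - 2^-1) * (1 - y ^+ 2) by exact: powR_nu1.
  have {H1} H1 : (weight L nu y *m Phi L nu y) m n =
      A nu y m * (n`!%:R * (L - n)`!%:R) * B / l ^+ 2.
    by rewrite -H1 mulrC mulKf // expf_neq0.
  have {H2} H2 : B = (l + 2 * nu + 1) * (l + 2 * nu) * (nu + l + 1)
      * (2 * (1 - y ^+ 2) * wpoly L (nu + 1) m n y) / (2 * nu + 1).
    by rewrite H2 mulrC mulKf.
  rewrite scalemx_ij rowW // H1 H2 cE /A ew KE.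
  move: (fact_neq0R R L) => L1.
  by field; rewrite l0 nz1 L1 nz4 nz3 nz2.
split; last exact: WS.
have c0 : cnu L nu != 0.
  by rewrite cE !mulf_neq0 ?invr_neq0 ?mulf_neq0 ?expf_neq0.
(* Near [x] the product W Phi is W^(nu+1) / c, whose entries are differentiated by
   [is_derive_wpoly]. *)
apply: (@near_eq_is_derive _ _ _
  (fun y => (cnu L nu)^-1 *: weight L (nu + 1) y)).
  have xI : x \in `]-1, 1[ by rewrite in_itv.
  near=> y; rewrite WS ?scalerA ?mulVf ?scale1r //.
  have : y \in `]-1, 1[ by near: y; exact: near_in_itvoo.
  by rewrite in_itv.
apply: is_derive_mx => m n.
have dw := is_derive_wpoly L m n hnu hx.
set K := (l + (nu + 1)) * poch (nu + 1) L.+1 / L`!%:R * (m`!%:R * (L - m)`!%:R)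
  * (n`!%:R * (L - n)`!%:R).
have -> : (fun y => ((cnu L nu)^-1 *: weight L (nu + 1) y) m n) =
    ((cnu L nu)^-1 * K) \*: (fun y : R => (1 - y ^+ 2) `^ (nu + 1 - 2^-1)
                               * wpoly L (nu + 1) m n y).
  apply/funext => y.
  by rewrite scalemx_ij rowW // /A /K /= /GRing.scale /=; ring.
apply: is_derive_eq.
have hm := ord_int_le m.
have [S [H1 H2]] : exists B,
    l ^+ 2 * (weight L nu x *m Psi L nu x) m n
      = - 2 * (l + 2 * nu + 1) * (A nu x m * (n`!%:R * (L - n)`!%:R)) * B /\
    (l + 2 * nu) * (nu + l + 1)
      * wsum L (fun c => tcoef L (nu + 1) m n c
                      * ((m%:Z + n%:Z - 2 * c)%:~R + (nu + 1))
                      * gegen nu (m%:Z + n%:Z - 2 * c + 1) x) = B.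
  eexists; split; first exact: (row_Psi (rowW nu x m hnu) (v_out nu x m) n hL x hnu).
  exact: (@wpoly_Psi R L nu m n x hnu hm).
have {H1} -> : (weight L nu x *m Psi L nu x) m n =
    - 2 * (l + 2 * nu + 1) * (A nu x m * (n`!%:R * (L - n)`!%:R)) * S / l ^+ 2.
  by rewrite -H1 mulrC mulKf // expf_neq0.
rewrite -{S}H2 /GRing.scale /= cE /K KE /A.
move: (fact_neq0R R L) => L1.
by field; rewrite l0 L1 nu_neq0 nz4 nz3 nz2 nz5 nz1.
Unshelve. all: by end_near.
Qed.
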